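(* Let $l \ge 1$ be the current length of the student's sorted list of schedules $S$ at the start of an iteration of binary insertion sort, i.e. at the moment when a new schedule $x \notin S$, which has not appeared in any comparison query so far, is to be inserted into $S$. Then, in the worst case (over the position of $x$ relative to the elements of $S$ in the student's strict preference order), the average number of additional schedule pairs for which the student's preference relation can be inferred, taken across all comparison queries generated until $x$ is inserted into $S$, is $$\frac{l}{\lceil \log_2 (l+1)\rceil}.$$ That is, the total number of additional schedule pairs whose relation is inferred when $x$ is inserted, divided by the number of comparison queries asked during the iteration, has worst-case (minimum) value $l/\lceil \log_2(l+1)\rceil$.
   Context: A student has a strict total preference order $\succ$ over course schedules. A comparison query (CQ) presents two schedules $x,x'$ and the student truthfully answers which one she prefers. $S = (S[0],\dots,S[l-1])$ is a list of distinct schedules sorted (from least to most preferred) according to the student's preferences, and the order of the elements of $S$ is already known from previous answers. One iteration of binary insertion sort for inserting $x$ into $S$: set $L \gets 0$, $R \gets l-1$; while $L \le R$, set $M \gets \lfloor (L+R)/2 \rfloor$ and ask the CQ comparing $x$ with $S[M]$; if the student answers $x \succ S[M]$ then set $L \gets M+1$, otherwise set $R \gets M-1$. When $L>R$, the position of $x$ is determined and $x$ is inserted into $S$. The preference relation of a pair of schedules ''can be inferred'' if it follows from the student's answers so far by transitivity. ''Additional'' pairs are those whose relation can be inferred after the insertion of $x$ but could not be inferred before the iteration started; since $x$ had appeared in no query, the pairs within $S$ were already known and no pair involving $x$ was known. *)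

(* Defs.v *)
(* MathComp, with MathComp-Analysis for the real logarithm. *)
From mathcomp Require Import all_boot all_order all_algebra.
From mathcomp Require Import reals exp.
From mathcomp Require Import zify.

Set Implicit Arguments.
Unset Strict Implicit.
Unset Printing Implicit Defensive.

Import Order.TTheory GRing.Theory Num.Theory.

Local Open Scope ring_scope.

Definition log2 {R : realType} (y : R) : R := ln y / ln 2.

Section Schedules.

(* The type of course schedules. *)
Variable T : finType.

(* [pref a b] reads "a is strictly preferred to b". *)
Record strict_total_preference (pref : rel T) : Prop := StrictTotalPreference {
  pref_irreflexive : irreflexive pref;
  pref_transitive : transitive pref;
  pref_total : forall a b, a != b -> pref a b || pref b a }.

(* An answered comparison query (a, b) records the answer "a is preferred to
   b"; a list of them is what is known about the student. *)
Definition answer (pref : rel T) (a b : T) : T * T :=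
  if pref a b then (a, b) else (b, a).

Definition truthful (pref : rel T) (Q : seq (T * T)) : bool :=
  all (fun q => pref q.1 q.2) Q.

Definition increasing (pref : rel T) (S : seq T) : bool :=
  sorted (fun a b => pref b a) S.

(* "a is preferred to b" follows from the answers Q by transitivity, i.e.
   (a, b) is in the (irreflexive) transitive closure of Q: one answer,
   followed by any number of further ones. *)
Definition infers (Q : seq (T * T)) (a b : T) : bool :=
  [exists c, ((a, c) \in Q) && connect (fun u v => (u, v) \in Q) c b].

(* The order of the elements of S, from least to most preferred, is known. *)
Definition order_known (Q : seq (T * T)) (S : seq T) : bool :=
  pairwise (fun a b => infers Q b a) S.

(* The unordered pairs whose relation, in one direction or the other, can be
   inferred from Q. *)
Definition known_pairs (Q : seq (T * T)) : {set {set T}} :=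
  [set [set p.1; p.2] | p : T * T & (p.1 != p.2) && infers Q p.1 p.2].

(* State of the loop of one iteration of binary insertion sort: the bounds L
   and R, which are integers since R may become -1, and the answers so far. *)
Record state := State { lo : int; hi : int; answers : seq (T * T) }.

Section Iteration.

Variables (pref : rel T) (S : seq T) (x : T).

Definition step (s : state) : state :=
  if lo s <= hi s then
    let M := ((lo s + hi s) %/ 2)%Z in
    let y := nth x S `|M|%N in
    if pref x y
    then State (M + 1) (hi s) (answer pref x y :: answers s)
    else State (lo s) (M - 1) (answer pref x y :: answers s)
  else s.

Definition start : state := State 0 ((size S)%:Z - 1) [::].

(* Each pass through the loop removes at least one index from [L, R], so that
   size S passes exhaust the loop (see insertion_loop_exits), and [step] does
   nothing once L > R. *)
Definition insertion_loop : state := iter (size S) step start.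

Lemma insertion_loop_exits : hi insertion_loop < lo insertion_loop.
Proof.
suff H n : hi (iter n step start) - lo (iter n step start) + 1
             <= Num.max 0 ((size S)%:Z - n%:Z).
  by have := H (size S); rewrite -/insertion_loop; lia.
elim: n => [|n IHn]; first by rewrite /=; lia.
rewrite iterS; move: (iter n step start) IHn => [l h q] /= IHn.
by rewrite /step /=; case: ifP => [lh|lh]; [case: (pref _ _) => /=|move=> /=]; lia.
Qed.

Definition insertion_queries : seq (T * T) := answers insertion_loop.

(* The pairs that can be inferred once x is inserted, but could not be
   inferred from the previous answers Q. *)
Definition additional_pairs (Q : seq (T * T)) : {set {set T}} :=
  known_pairs (insertion_queries ++ Q) :\: known_pairs Q.

Definition average_additional_pairs (R : realType) (Q : seq (T * T)) : R :=
  #|additional_pairs Q|%:R / (size insertion_queries)%:R.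

End Iteration.

(* The strict preference orders the student may have, given that S is sorted
   and that the answers in Q are truthful. *)
Definition possible_preference (S : seq T) (Q : seq (T * T)) (pref : rel T) :
    Prop :=
  [/\ strict_total_preference pref, increasing pref S & truthful pref Q].

End Schedules.

(* Main.v *)
(* When the loop exits, x has been compared with both of its neighbours in S, so
   by transitivity exactly the l pairs {x, y} with y in S become known, whatever
   the position of x.  The worst case is thus the largest number of queries:
   a query on n indices leaves (n - 1)./2 or n./2 of them, so at most
   up_log 2 l.+1 queries are asked, and the larger half is always kept when x is
   preferred to all of S. *)
Require Import Defs.
From mathcomp Require Import all_boot all_order all_algebra.
From mathcomp Require Import reals exp.
From mathcomp Require Import zify.

Set Implicit Arguments.
Unset Strict Implicit.
Unset Printing Implicit Defensive.

Import Order.TTheory GRing.Theory Num.Theory.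

Local Open Scope ring_scope.

(** For [n > 1] and [k = up_log 2 n], taking [ln] in [2 ^ (k - 1) < n <= 2 ^ k] and dividing by
    [ln 2 > 0] puts the logarithm in the interval []k - 1, k]]. *)
Lemma ceil_log2_nat (R : realType) (n : nat) :
  Num.ceil (log2 (n%:R : R)) = (up_log 2 n)%:Z.
Proof.
have ln2_gt0 : 0 < ln (2 : R) by rewrite ln_gt0 ?ltr1n.
have [n_le1|n_gt1] := leqP n 1.
  suff -> : log2 (n%:R : R) = 0.
    have /eqP -> : up_log 2 n == 0%N by rewrite up_log_eq0 n_le1.
    by rewrite ceil0.
  have [->|->] : n = 0%N \/ n = 1%N by lia.
    (* [ln] is 0 at 0 by convention, which agrees with [up_log 2 0 = 0]. *)
    by rewrite /log2 ln0 ?mul0r.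
  by rewrite /log2 ln1 mul0r.
have /andP[lt_n n_le] := up_log_bounds (isT : (1 < 2)%N) n_gt1.
have /prednK k_eq : (0 < up_log 2 n)%N by rewrite up_log_gt0.
have n_pos : (n%:R : R) \is Num.pos by rewrite posrE ltr0n ltnW.
have exp_pos k : (2 ^+ k : R) \is Num.pos by rewrite posrE exprn_gt0.
have lnX k : ln (2 ^+ k : R) = k%:R * ln 2 by rewrite lnXn// mulr_natl.
apply: ceil_def; apply/andP; split.
  rewrite -k_eq -addn1 PoszD addrK ltr_pdivlMr// -lnX ltr_ln//.
  by rewrite -natrX ltr_nat.
by rewrite ler_pdivrMr// -lnX ler_ln// -natrX ler_nat.
Qed.

(** * Transitive closure of a list of answers *)

Section Inference.

Variable T : finType.
Implicit Types (Q : seq (T * T)) (a b c : T).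

Lemma infers_answer Q a b : (a, b) \in Q -> infers Q a b.
Proof. by move=> ab; apply/existsP; exists b; rewrite ab connect0. Qed.

Lemma infers_trans Q a b c : infers Q a b -> infers Q b c -> infers Q a c.
Proof.
move=> /existsP[d /andP[ad db]] /existsP[e /andP[be ec]].
apply/existsP; exists d; rewrite ad.
exact: connect_trans db (connect_trans (connect1 be) ec).
Qed.

Lemma sub_infers Q Q' a b : {subset Q <= Q'} -> infers Q a b -> infers Q' a b.
Proof.
move=> QQ' /existsP[c /andP[ac cb]]; apply/existsP; exists c.
rewrite QQ'//=; apply: connect_sub cb => u v uv.
by apply: connect1; exact: QQ'.
Qed.

(** A chain of answers never leaves [A]. With [A] taken as [S], nothing about [x] was known before;
    with [x :: S], no other schedule gets involved afterwards. *)
Lemma infers_endpoints (A : {pred T}) Q a b :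
  all (fun q => (q.1 \in A) && (q.2 \in A)) Q -> infers Q a b ->
  (a \in A) && (b \in A).
Proof.
move=> /allP QA /existsP[c /andP[/QA /andP[/= -> cA]]] /connectP[p + ->].
elim: p c cA => //= d p IHp c _ /andP[/QA /andP[_ dA]].
exact: IHp.
Qed.

Lemma mem_known_pairs Q a b :
  a != b -> ([set a; b] \in known_pairs Q) = infers Q a b || infers Q b a.
Proof.
move=> ab; apply/imsetP/orP => [[[c d]]|].
  rewrite inE => /andP[/= _ cdQ] abE.
  have : a \in [set c; d] by rewrite -abE set21.
  have : b \in [set c; d] by rewrite -abE set22.
  rewrite !inE => /orP[]/eqP bE /orP[]/eqP aE; move: ab.
  - by rewrite aE bE eqxx.
  - by rewrite aE bE; right.
  - by rewrite aE bE; left.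
  - by rewrite aE bE eqxx.
case=> [abQ|baQ]; first by exists (a, b); rewrite // inE ab.
by exists (b, a); rewrite 1?setUC // inE /= eq_sym ab.
Qed.

End Inference.

(** * Loop invariants and the number of queries *)

Section Insertion.

Variables (T : finType) (pref : rel T) (S : seq T) (x : T).

Let loop := insertion_loop pref S x.
Let queries := insertion_queries pref S x.

(** [step] fixes a state with [hi s < lo s], so an invariant only has to survive the passes that ask
    a query. *)
Lemma insertion_loop_ind (P : state T -> Prop) :
  P (start S) ->
  (forall s, lo s <= hi s -> P s -> P (step pref S x s)) ->
  P loop.
Proof.
move=> Pstart Pstep; rewrite /loop /insertion_loop.
elim: (size S) => // n; rewrite iterS; move: (iter _ _ _) => s Ps.
by have [/Pstep|] := boolP (lo s <= hi s); [exact | rewrite /step => /negPf ->].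
Qed.

(* The answers already made place x strictly between the elements of indices
   lo - 1 and hi + 1, whenever these exist. *)
Lemma insertion_loop_bracket :
  [/\ 0 <= lo loop, lo loop <= hi loop + 1, hi loop < (size S)%:Z,
      0 < lo loop -> (x, nth x S `|(lo loop - 1)%R|%N) \in queries
    & hi loop + 1 < (size S)%:Z -> (nth x S `|(hi loop + 1)%R|%N, x) \in queries].
Proof.
rewrite /queries /insertion_queries -/loop.
elim/insertion_loop_ind: loop => [|[l h q] /= lh [l0 lh1 hS lq hq]].
  by split=> //=; lia.
rewrite /step /= lh /answer.
set M := ((l + h) %/ 2)%Z.
have [lM Mh] : l <= M /\ M <= h by rewrite /M; lia.
case: (pref x _) => /=; split=> //=; try lia; rewrite ?addrK ?subrK inE ?eqxx //.
- by move=> /hq ->; rewrite orbT.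
- by move=> /lq ->; rewrite orbT.
Qed.

Lemma insertion_queries_endpoints :
  all (fun q => (q.1 \in x :: S) && (q.2 \in x :: S)) queries.
Proof.
rewrite /queries /insertion_queries -/loop.
elim/insertion_loop_ind: loop => // [[l h q] /= lh IHq].
have nthS i : nth x S i \in x :: S.
  have [iS|Si] := ltnP i (size S); first by rewrite inE mem_nth ?orbT.
  (* The default value of [nth] is [x], so no bound on the index is needed. *)
  by rewrite nth_default ?mem_head.
rewrite /step /= lh /answer.
by case: (pref x _) => /=; rewrite nthS mem_head IHq.
Qed.

(** With [n] indices left, [up_log 2 n.+1] serves as a budget for the remaining queries; the sum of
    queries asked and budget never grows. *)
Lemma size_insertion_queries :
  (size queries <= up_log 2 (size S).+1)%N.
Proof.
suff [] : lo loop <= hi loop + 1 /\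
    (size queries + up_log 2 `|(hi loop - lo loop + 2)%R| <=
       up_log 2 (size S).+1)%N by lia.
rewrite /queries /insertion_queries -/loop.
elim/insertion_loop_ind: loop => [|[l h q] /= lh [_ IHq]].
  by rewrite /= -addn1; split; [lia | rewrite leq_up_log //; lia].
rewrite /step /= lh.
set n := `|(h - l + 1)%R|%N.
have nE : `|(h - l + 2)%R|%N = n.+1 by lia.
have n_gt0 : (0 < n)%N by lia.
(* [up_log 2 n.+1] is one more than [up_log 2 (n./2).+1]: that unit pays for the query, and either
   answer leaves at most [n./2] indices. *)
rewrite nE up_log2S // addnS -addSn in IHq.
case: (pref x _) => /=; (split; first by lia);
  by apply: leq_trans IHq; rewrite leq_add2l leq_up_log //; lia.
Qed.

(** Every answer moves [lo] and keeps exactly [n./2] of [n] indices, so the budget inequality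
    becomes an equality; [hi] never moves. *)
Lemma size_insertion_queries_top :
  {in S, forall y, pref x y} -> size queries = up_log 2 (size S).+1.
Proof.
move=> x_top.
suff [_ [_ [lh]]] : 0 <= lo loop /\ hi loop = (size S)%:Z - 1 /\
    lo loop <= hi loop + 1 /\
    (size queries + up_log 2 `|(hi loop - lo loop + 2)%R|)%N =
       up_log 2 (size S).+1.
  have := insertion_loop_exits pref S x; rewrite -/loop => hl.
  (* At exit no index is left, and the budget is [up_log 2 1 = 0]. *)
  have -> : `|(hi loop - lo loop + 2)%R|%N = 1%N by lia.
  by rewrite up_log1 addn0.
rewrite /queries /insertion_queries -/loop.
elim/insertion_loop_ind: loop => [|[l h q] /= lh [l0 [hE [_ IHq]]]].
  rewrite /=; do 3?[split; first by lia].
  by congr (up_log 2 _); lia.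
rewrite /step /= lh; set M := ((l + h) %/ 2)%Z.
have [lM Mh] : l <= M /\ M <= h by rewrite /M; lia.
(* Hence [nth] yields an element of [S], not the default [x], and [x_top] applies. *)
have MS : (`|M| < size S)%N by lia.
rewrite x_top ?mem_nth //=.
do 3?[split; first by lia].
have n_gt0 : (0 < `|(h - l + 1)%R|)%N by lia.
have nE : `|(h - l + 2)%R|%N = `|(h - l + 1)%R|.+1 by lia.
by rewrite -IHq nE (up_log2S n_gt0) addnS -addSn; congr (_ + up_log 2 _)%N; lia.
Qed.

(** At exit [x] has at least one neighbour in a nonempty [S], and the bracket provides an answer
    about it. *)
Lemma size_insertion_queries_gt0 : (0 < size S)%N -> (0 < size queries)%N.
Proof.
move=> S_gt0; have [l0 _ hS lq hq] := insertion_loop_bracket.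
have := insertion_loop_exits pref S x; rewrite -/loop => hl.
case: queries lq hq => //= lq hq.
have [/lq //|l_le0] := ltP 0 (lo loop).
by have /hq : hi loop + 1 < (size S)%:Z by lia.
Qed.

(** * Counting the additional pairs *)

Section AdditionalPairs.

Variable Q : seq (T * T).
Hypothesis S_known : order_known Q S.

(** An element of index below [lo] is [S[lo - 1]] or lies below it; any other has index at least
    [hi + 1], so it is [S[hi + 1]] or lies above it. The known order of [S] extends the answer about
    that neighbour to [y]. *)
Lemma infers_insertion y : y \in S ->
  infers (queries ++ Q) x y || infers (queries ++ Q) y x.
Proof.
move=> yS; have [l0 lh hS lq hq] := insertion_loop_bracket.
have := insertion_loop_exits pref S x; rewrite -/loop => hl.
have iS : (index y S < size S)%N by rewrite index_mem.
rewrite -(nth_index x yS); set i := index y S in iS *.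
have newI a b : (a, b) \in queries -> infers (queries ++ Q) a b.
  by move=> ab; rewrite infers_answer // mem_cat ab.
have oldI j k : (j < k)%N -> (k < size S)%N ->
    infers (queries ++ Q) (nth x S k) (nth x S j).
  move=> jk kS; apply: (@sub_infers _ Q).
    by move=> q qQ; rewrite mem_cat qQ orbT.
  have /(pairwiseP x) := S_known; apply=> //; rewrite inE //.
  exact: ltn_trans kS.
have [il|li] := ltP i%:Z (lo loop).
  have l_gt0 : 0 < lo loop by lia.
  apply/orP; left; have := newI _ _ (lq l_gt0).
  have [-> //|ni] := eqVneq i `|(lo loop - 1)%R|%N.
  by move=> /infers_trans; apply; apply: oldI; lia.
have h_lt : hi loop + 1 < (size S)%:Z by lia.
apply/orP; right; have := newI _ _ (hq h_lt).
have [-> //|ni] := eqVneq i `|(hi loop + 1)%R|%N.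
by apply: infers_trans; apply: oldI; lia.
Qed.

Hypothesis x_new : x \notin S.
Hypothesis Q_S : all (fun q => (q.1 \in S) && (q.2 \in S)) Q.

Lemma additional_pairsE :
  additional_pairs pref S x Q = [set [set x; y] | y in S].
Proof.
have xS y : y \in S -> x != y by move=> yS; apply: contraNneq x_new => ->.
apply/setP => A; rewrite inE; apply/andP/imsetP => [[+ /imsetP[[a b]]]|].
  rewrite inE => /[swap] /andP[/= ab abQ] /[swap] ->; rewrite mem_known_pairs // => AQ.
  have /andP[] : (a \in x :: S) && (b \in x :: S).
    apply: infers_endpoints abQ; rewrite all_cat insertion_queries_endpoints.
    apply: sub_all Q_S => q /andP[q1 q2].
    by rewrite !inE q1 q2 !orbT.
  rewrite !inE => /predU1P[ax|aS] /predU1P[bx|bS].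
  - by rewrite ax bx eqxx in ab.
  - by exists b; rewrite ?ax.
  - by exists a; rewrite // bx setUC.
  - case/negP: AQ; have /(pairwiseP x) known := S_known.
    rewrite -(nth_index x aS) -(nth_index x bS).
    have [lt_ab|lt_ba|eq_ab] := ltngtP (index a S) (index b S).
    + by rewrite orbC known // inE index_mem.
    + by rewrite known // inE index_mem.
    + by rewrite -(nth_index x aS) eq_ab nth_index // eqxx in ab.
move=> [y yS ->]; rewrite !mem_known_pairs ?xS // infers_insertion //.
split=> //; apply/negP => /orP[] /(infers_endpoints Q_S) /andP[];
  by rewrite (negPf x_new).
Qed.

Lemma card_additional_pairs :
  uniq S -> #|additional_pairs pref S x Q| = size S.
Proof.
move=> uniq_S; rewrite additional_pairsE card_in_imset ?(card_uniqP uniq_S) //.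
move=> y z yS zS yzE; have : y \in [set x; z] by rewrite -yzE set22.
by rewrite !inE => /predU1P[yx|/eqP //]; move: x_new; rewrite -yx yS.
Qed.

End AdditionalPairs.

End Insertion.

(** * The extremal preference *)

Section TopPreference.

Variables (T : finType) (pref : rel T) (x : T).

(** The order [pref] with [x] moved to the top. *)
Definition top_pref : rel T := fun a b => (b != x) && ((a == x) || pref a b).

Lemma top_pref_out : {in predC1 x &, top_pref =2 pref}.
Proof. by move=> a b; rewrite /top_pref !inE => /negPf -> ->. Qed.

Lemma strict_total_top_pref :
  strict_total_preference pref -> strict_total_preference top_pref.
Proof.
move=> [irr tr tot]; split; rewrite /top_pref.
- by move=> a; rewrite irr orbF andNb.
- move=> b a c /andP[/negPf -> ab] /andP[-> /= bc].
  by case/orP: ab => [-> //|/tr -> //]; rewrite orbT.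
- move=> a b ab.
  have [ax|ax] := eqVneq a x; first by rewrite -ax eq_sym ab.
  by rewrite orFb; case: eqVneq => //= bx; exact: tot.
Qed.

(** Neither [S] nor [Q] mentions [x], and the two orders agree away from [x]. *)
Lemma possible_top_pref (S : seq T) (Q : seq (T * T)) :
  x \notin S -> all (fun q => (q.1 \in S) && (q.2 \in S)) Q ->
  possible_preference S Q pref -> possible_preference S Q top_pref.
Proof.
move=> x_new /allP Q_S [total_pref incr true_Q].
have neqx y : y \in S -> y \in predC1 x.
  by move=> yS; rewrite inE; apply: contraNneq x_new => <-.
split; first exact: strict_total_top_pref.
- rewrite /increasing (@eq_in_sorted _ (predC1 x) _ (fun a b => pref b a)) //.
    by move=> a b ax bx; exact: top_pref_out.
  exact/allP.
- apply/allP => q qQ; have /andP[q1 q2] := Q_S q qQ.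
  by rewrite top_pref_out ?neqx //; exact: (allP true_Q).
Qed.

End TopPreference.

Theorem proposition1 (R : realType) (T : finType) (l : nat)
    (S : seq T) (x : T) (Q : seq (T * T)) (student : rel T)
    (l_ge1 : (1 <= l)%N)
    (size_S : size S = l)
    (uniq_S : uniq S)
    (x_new : x \notin S)
    (* the previous queries compared elements of S only (so none involved x) *)
    (Q_S : all (fun q => (q.1 \in S) && (q.2 \in S)) Q)
    (student_pref : possible_preference S Q student)
    (S_known : order_known Q S) :
  let bound : R := l%:R / (Num.ceil (log2 (l.+1%:R : R)))%:~R in
  (forall pref : rel T, possible_preference S Q pref ->
     bound <= average_additional_pairs pref S x R Q) /\
  (exists2 pref : rel T, possible_preference S Q pref &
     average_additional_pairs pref S x R Q = bound).
Proof.
move=> bound.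
have boundE : bound = l%:R / (up_log 2 l.+1)%:R.
  by rewrite /bound ceil_log2_nat.
(* The numerator is the same for every [pref]; only query counts remain to be compared. *)
have averageE pref : average_additional_pairs pref S x R Q =
    l%:R / (size (insertion_queries pref S x))%:R.
  by rewrite /average_additional_pairs card_additional_pairs // size_S.
split=> [pref _|].
  (* Inversion reverses the order only between positive numbers, and [0^-1 = 0]. *)
  have q_gt0 : (0 < size (insertion_queries pref S x))%N.
    by rewrite size_insertion_queries_gt0 ?size_S.
  rewrite averageE boundE ler_wpM2l ?ler0n // lef_pV2 ?posrE ?ltr0n //.
    by rewrite ler_nat -size_S size_insertion_queries.
  by rewrite up_log_gt0.
exists (top_pref student x); first exact: possible_top_pref.
rewrite averageE boundE size_insertion_queries_top ?size_S // => y yS.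
by rewrite /top_pref eqxx andbT; apply: contraNneq x_new => <-.
Qed.
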